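(* Let $f$ be a locally univalent analytic function in the unit disk $\mathbb{D}$. Then: (i) if $\alpha_f<\infty$, then for all $z\in\mathbb{D}$ $$\left|P_f(z)-\frac{\alpha_f^2-1}{\alpha_f^2-|z|^2}\,z\right|\ge \alpha_f\,\frac{1-|z|^2}{\alpha_f^2-|z|^2};$$ (ii) for all $z\in\mathbb{D}$ with $|z|<\mu_f$ $$\left|P_f(z)-\frac{\mu_f^2-1}{\mu_f^2-|z|^2}\,z\right|\le \mu_f\,\frac{1-|z|^2}{\mu_f^2-|z|^2}.$$
   Context: $\mathbb{D}=\{z\in\mathbb{C}:|z|<1\}$. A function $f$ analytic in $\mathbb{D}$ is locally univalent if $f'(z)\neq 0$ for all $z\in\mathbb{D}$. For such $f$, the pole function is $P_f(z)=z+2\,f'(z)/f''(z)\in\mathbb{C}\cup\{\infty\}$, with $P_f(z)=\infty$ when $f''(z)=0$; for $c\in\mathbb{C}$, $|\infty-c|=+\infty$. Put $A_f(z)=\frac{1-|z|^2}{2}\,\frac{f''(z)}{f'(z)}-\overline{z}$. The upper order and lower order of $f$ are $\alpha_f=\sup_{z\in\mathbb{D}}|A_f(z)|$ and $\mu_f=\inf_{z\in\mathbb{D}}|A_f(z)|$. It is known (Pommerenke) that $\alpha_f\ge 1$ always. *)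

(* Defs.v *)
From Stdlib Require Import Reals.
From Coquelicot Require Import Coquelicot.

Local Open Scope R_scope.

Definition unit_disk (z : C) : Prop := Cmod z < 1.

(* Functions on the disk are total functions [C -> C]; every notion below only
   depends on their values in the (open) disk. *)

Definition analytic_at (f : C -> C) (z0 : C) : Prop :=
  exists (a : nat -> C) (r : R), 0 < r /\
    forall z : C, Cmod (z - z0)%C < r ->
      @is_pseries C_AbsRing C_NormedModule a (z - z0)%C (f z).

Definition analytic_in_disk (f : C -> C) : Prop :=
  forall z : C, unit_disk z -> analytic_at f z.

(* Coquelicot's [C_derive] takes the limit of the difference quotient along
   real increments; by [is_C_derive_unique] it is the complex derivative wherever
   the function is complex differentiable, in particular where it is analytic. *)
Definition locally_univalent (f : C -> C) : Prop :=
  analytic_in_disk f /\ forall z : C, unit_disk z -> C_derive f z <> RtoC 0.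

Definition C_derive2 (f : C -> C) : C -> C := C_derive (C_derive f).

(* The extended plane: [None] is the point at infinity. *)
Definition extC : Type := option C.

Definition extC_dist (p : extC) (c : C) : Rbar :=
  match p with
  | Some w => Finite (Cmod (w - c)%C)
  | None => p_infty
  end.

Definition pole (f : C -> C) (z : C) : extC :=
  if Ceq_dec (C_derive2 f z) (RtoC 0) then None
  else Some (z + RtoC 2 * (C_derive f z / C_derive2 f z))%C.

Definition Aop (f : C -> C) (z : C) : C :=
  (RtoC ((1 - Cmod z ^ 2) / 2) * (C_derive2 f z / C_derive f z) - Cconj z)%C.

Definition upper_order (f : C -> C) : Rbar :=
  Lub_Rbar (fun x : R => exists z : C, unit_disk z /\ x = Cmod (Aop f z)).

Definition lower_order (f : C -> C) : Rbar :=
  Glb_Rbar (fun x : R => exists z : C, unit_disk z /\ x = Cmod (Aop f z)).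

(* Main.v *)
Require Import Defs.
From Stdlib Require Import Reals Lra.
From Coquelicot Require Import Coquelicot.

Local Open Scope R_scope.

(** The theorem is pointwise in [z]: with [A = Aop f z] and [r = Cmod z < 1],
    it follows from [f' <> 0] and the bounds
    [lower_order f <= Cmod A <= upper_order f].

    Solving the definition of [A] for [f''/f'] gives
    [f''/f' = 2 (A + Cconj z) / (1 - r^2)].  So where [f'' <> 0] the pole is
    [z + (1 - r^2) / (A + Cconj z)], and for real [t > r]
    [[
       pole - (t^2-1)/(t^2-r^2) z
         = (1-r^2)/(t^2-r^2) * ((t^2 + z A) / (A + Cconj z)).
    ]]
    Comparing the distance from the pole to the center with the radius
    [t (1-r^2)/(t^2-r^2)] is thus comparing [Cmod (t^2 + z A)] with
    [t * Cmod (A + Cconj z)] ([extC_dist_pole]).  By the identity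
    [[
       |t^2 + z A|^2 - t^2 |A + Cconj z|^2 = (t^2 - r^2) (t^2 - |A|^2)
    ]]
    ([Cmod_sqr_gap]) this depends only on the sign of [t - |A|].  The upper
    order is a [t] with [|A| <= t], which gives (i); the lower order is a [t]
    with [t <= |A|], which gives (ii).

    Where [f'' = 0] the pole is infinite, so (i) is trivial; in (ii) this case
    is excluded, because it forces [|A| = r]. *)

(** For [0 < t <> Cmod z], the Möbius map taking [A] to
    [(t^2 + z A) / (t (A + Cconj z))] sends the circle [Cmod A = t] onto the unit
    circle, which explains the factor [t^2 - |A|^2]. *)
Lemma Cmod_sqr_gap (t : R) (z A : C) :
  Cmod (RtoC (t ^ 2) + z * A) ^ 2 - (t * Cmod (A + Cconj z)) ^ 2
  = (t ^ 2 - Cmod z ^ 2) * (t ^ 2 - Cmod A ^ 2).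
Proof.
  rewrite Rpow_mult_distr, !Cmod2_alt.
  destruct z as [x y], A as [a b]; simpl; ring.
Qed.

Lemma Cmod_numerator_ge (t : R) (z A : C) :
  Cmod z <= t -> Cmod A <= t ->
  t * Cmod (A + Cconj z) <= Cmod (RtoC (t ^ 2) + z * A).
Proof.
  intros Hz HA.
  pose proof (Cmod_ge_0 z) as Hz0; pose proof (Cmod_ge_0 A) as HA0.
  apply Rsqr_incr_0_var; [rewrite !Rsqr_pow2 | apply Cmod_ge_0].
  pose proof (Cmod_sqr_gap t z A) as Hgap.
  assert (0 <= (t ^ 2 - Cmod z ^ 2) * (t ^ 2 - Cmod A ^ 2))
    by (apply Rmult_le_pos; nra).
  lra.
Qed.

Lemma Cmod_numerator_le (t : R) (z A : C) :
  Cmod z <= t -> t <= Cmod A ->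
  Cmod (RtoC (t ^ 2) + z * A) <= t * Cmod (A + Cconj z).
Proof.
  intros Hz HA.
  pose proof (Cmod_ge_0 z) as Hz0.
  apply Rsqr_incr_0_var; [rewrite !Rsqr_pow2 |].
  - pose proof (Cmod_sqr_gap t z A) as Hgap.
    assert (0 <= (t ^ 2 - Cmod z ^ 2) * (Cmod A ^ 2 - t ^ 2))
      by (apply Rmult_le_pos; nra).
    lra.
  - apply Rmult_le_pos; [lra | apply Cmod_ge_0].
Qed.

Lemma Aop_plus_conj (f : C -> C) (z : C) :
  (Aop f z + Cconj z
   = RtoC ((1 - Cmod z ^ 2) / 2) * (C_derive2 f z / C_derive f z))%C.
Proof. unfold Aop; ring. Qed.

Lemma Aop_plus_conj_neq_0 (f : C -> C) (z : C) :
  unit_disk z -> C_derive f z <> RtoC 0 -> C_derive2 f z <> RtoC 0 ->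
  (Aop f z + Cconj z)%C <> RtoC 0.
Proof.
  unfold unit_disk; intros Hz H1 H2; rewrite Aop_plus_conj.
  pose proof (Cmod_ge_0 z) as Hz0.
  apply Cmult_neq_0.
  - intros H; apply RtoC_inj in H; nra.
  - unfold Cdiv; apply Cmult_neq_0; [exact H2 |].
    intros H; apply C1_nz.
    now rewrite <- (Cinv_r _ H1), H, Cmult_0_r.
Qed.

Lemma pole_Aop (f : C -> C) (z : C) :
  unit_disk z -> C_derive f z <> RtoC 0 -> C_derive2 f z <> RtoC 0 ->
  pole f z = Some (z + RtoC (1 - Cmod z ^ 2) / (Aop f z + Cconj z))%C.
Proof.
  unfold unit_disk; intros Hz H1 H2; rewrite Aop_plus_conj; unfold pole.
  destruct (Ceq_dec (C_derive2 f z) (RtoC 0)) as [H | _]; [contradiction |].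
  pose proof (Cmod_ge_0 z) as Hz0.
  assert (Hs : RtoC (1 - Cmod z ^ 2) <> RtoC 0)
    by (intros H; apply RtoC_inj in H; nra).
  do 2 f_equal.
  rewrite RtoC_div by lra.
  field; repeat split; try assumption.
Qed.

Lemma extC_dist_pole (f : C -> C) (z : C) (t : R) :
  unit_disk z -> C_derive f z <> RtoC 0 -> C_derive2 f z <> RtoC 0 ->
  Cmod z < t ->
  extC_dist (pole f z) (RtoC ((t ^ 2 - 1) / (t ^ 2 - Cmod z ^ 2)) * z)%C
  = Finite ((1 - Cmod z ^ 2) / (t ^ 2 - Cmod z ^ 2)
            * (Cmod (RtoC (t ^ 2) + z * Aop f z) / Cmod (Aop f z + Cconj z))).
Proof.
  intros Hz H1 H2 Ht.
  pose proof (Aop_plus_conj_neq_0 f z Hz H1 H2) as HA.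
  rewrite (pole_Aop f z Hz H1 H2); unfold extC_dist; f_equal.
  unfold unit_disk in Hz; pose proof (Cmod_ge_0 z) as Hz0.
  assert (Hd : 0 < t ^ 2 - Cmod z ^ 2) by nra.
  assert (Hdc : RtoC (t ^ 2 - Cmod z ^ 2) <> RtoC 0)
    by (intros H; apply RtoC_inj in H; lra).
  rewrite <- Cmod_div by exact HA.
  rewrite <- (Rabs_pos_eq ((1 - Cmod z ^ 2) / (t ^ 2 - Cmod z ^ 2)))
    by (apply Rdiv_le_0_compat; nra).
  rewrite <- Cmod_R, <- Cmod_mult; f_equal.
  rewrite !RtoC_div by lra.
  revert Hdc; rewrite !RtoC_minus, Cmod2_conj; intros Hdc.
  field; split; assumption.
Qed.

Lemma Cmod_Aop_le_upper_order (f : C -> C) (z : C) :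
  unit_disk z -> Rbar_le (Finite (Cmod (Aop f z))) (upper_order f).
Proof.
  intros Hz; apply (proj1 (Lub_Rbar_correct _)); now exists z.
Qed.

Lemma lower_order_le_Cmod_Aop (f : C -> C) (z : C) :
  unit_disk z -> Rbar_le (lower_order f) (Finite (Cmod (Aop f z))).
Proof.
  intros Hz; apply (proj1 (Glb_Rbar_correct _)); now exists z.
Qed.

(** The comparison of moduli settles the case [Cmod z < t]; for [t <= Cmod z]
    the left-hand side is nonpositive. *)
Lemma pole_dist_ge (f : C -> C) (z : C) (t : R) :
  unit_disk z -> C_derive f z <> RtoC 0 -> Cmod (Aop f z) <= t ->
  Rbar_le
    (Finite (t * ((1 - Cmod z ^ 2) / (t ^ 2 - Cmod z ^ 2))))
    (extC_dist (pole f z)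
       (RtoC ((t ^ 2 - 1) / (t ^ 2 - Cmod z ^ 2)) * z)%C).
Proof.
  intros Hz H1 HA.
  destruct (Ceq_dec (C_derive2 f z) (RtoC 0)) as [H2 | H2].
  { unfold pole; destruct (Ceq_dec (C_derive2 f z) (RtoC 0));
      [exact I | contradiction]. }
  pose proof (Cmod_ge_0 (Aop f z)) as HA0; pose proof (Cmod_ge_0 z) as Hz0.
  destruct (Rlt_le_dec (Cmod z) t) as [Ht | Ht].
  - rewrite (extC_dist_pole f z t Hz H1 H2 Ht); cbn [Rbar_le].
    pose proof (Aop_plus_conj_neq_0 f z Hz H1 H2) as HB.
    apply Cmod_gt_0 in HB; unfold unit_disk in Hz.
    rewrite Rmult_comm; apply Rmult_le_compat_l.
    + apply Rdiv_le_0_compat; nra.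
    + apply Rle_div_r; [exact HB |].
      apply Cmod_numerator_ge; lra.
  - unfold pole; destruct (Ceq_dec (C_derive2 f z) (RtoC 0)); [exact I |].
    cbn [Rbar_le]; eapply Rle_trans; [| apply Cmod_ge_0].
    unfold unit_disk in Hz.
    assert (Hi : / (t ^ 2 - Cmod z ^ 2) <= 0).
    { destruct (Req_dec (t ^ 2 - Cmod z ^ 2) 0) as [-> | Hne].
      - (* For [t = Cmod z] the radius is a quotient by zero, whose value is [0]. *)
        rewrite Rinv_0; lra.
      - apply Rlt_le, Rinv_lt_0_compat; nra. }
    unfold Rdiv; rewrite <- Rmult_assoc.
    assert (0 <= t * (1 - Cmod z ^ 2)) by (apply Rmult_le_pos; nra).
    rewrite <- (Rmult_0_r (t * (1 - Cmod z ^ 2))); now apply Rmult_le_compat_l.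
Qed.

Lemma pole_dist_le (f : C -> C) (z : C) (t : R) :
  unit_disk z -> C_derive f z <> RtoC 0 ->
  Cmod z < t -> t <= Cmod (Aop f z) ->
  Rbar_le
    (extC_dist (pole f z)
       (RtoC ((t ^ 2 - 1) / (t ^ 2 - Cmod z ^ 2)) * z)%C)
    (Finite (t * ((1 - Cmod z ^ 2) / (t ^ 2 - Cmod z ^ 2)))).
Proof.
  intros Hz H1 Ht HA.
  pose proof (Cmod_ge_0 z) as Hz0.
  (* If [f''] vanished at [z], then [A = - Cconj z], of modulus [r < t]. *)
  assert (H2 : C_derive2 f z <> RtoC 0).
  { intros H2.
    assert (E : Aop f z = (- Cconj z)%C)
      by (unfold Aop; rewrite H2; unfold Cdiv; ring).
    rewrite E, Cmod_opp, Cmod_conj in HA; lra. }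
  rewrite (extC_dist_pole f z t Hz H1 H2 Ht); cbn [Rbar_le].
  pose proof (Aop_plus_conj_neq_0 f z Hz H1 H2) as HB.
  apply Cmod_gt_0 in HB; unfold unit_disk in Hz.
  rewrite (Rmult_comm t); apply Rmult_le_compat_l.
  - apply Rdiv_le_0_compat; nra.
  - apply Rle_div_l; [exact HB |].
    apply Cmod_numerator_le; lra.
Qed.

Theorem theorem3p4 (f : C -> C) (hf : locally_univalent f) :
  (Rbar_lt (upper_order f) p_infty ->
   let alpha : R := real (upper_order f) in
   forall z : C, unit_disk z ->
     Rbar_le
       (Finite (alpha * ((1 - Cmod z ^ 2) / (alpha ^ 2 - Cmod z ^ 2))))
       (extC_dist (pole f z)
          (RtoC ((alpha ^ 2 - 1) / (alpha ^ 2 - Cmod z ^ 2)) * z)%C))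
  /\
  (let mu : R := real (lower_order f) in
   forall z : C, unit_disk z ->
     Rbar_lt (Finite (Cmod z)) (lower_order f) ->
     Rbar_le
       (extC_dist (pole f z)
          (RtoC ((mu ^ 2 - 1) / (mu ^ 2 - Cmod z ^ 2)) * z)%C)
       (Finite (mu * ((1 - Cmod z ^ 2) / (mu ^ 2 - Cmod z ^ 2))))).
Proof.
  destruct hf as [_ hf']; split.
  - intros Hfin alpha z Hz.
    apply pole_dist_ge; [exact Hz | now apply hf' |].
    pose proof (Cmod_Aop_le_upper_order f z Hz) as HA.
    unfold alpha; destruct (upper_order f); simpl in *; tauto.
  - intros mu z Hz Hmu.
    pose proof (lower_order_le_Cmod_Aop f z Hz) as HA.
    apply pole_dist_le; [exact Hz | now apply hf' | |];
      unfold mu; destruct (lower_order f); simpl in *; tauto.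
Qed.
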